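(* Let $id$ denote the identity map on $\mathcal{L}(\mathcal{H}_n)$. Then $\mathcal{M}_{\{id\}} = \mathcal{CP}$, i.e. the convex mapping cone generated by the identity map is exactly the cone of completely positive maps on $\mathcal{L}(\mathcal{H}_n)$.
   Context: $\mathcal{H}_n$ is an $n$-dimensional complex Hilbert space and $\mathcal{L}(\mathcal{H}_n)$ is the space of linear operators on it. A linear map $\Phi:\mathcal{L}(\mathcal{H}_n)\to\mathcal{L}(\mathcal{H}_n)$ is positive if $\Phi(X)\ge 0$ whenever $X\ge 0$ (positive semidefinite), and completely positive if $id_k\otimes\Phi$ is positive for every $k\in\mathbb{N}$, where $id_k$ is the identity map on $\mathcal{L}(\mathcal{H}_k)$. $\mathcal{P}_1$ and $\mathcal{CP}$ denote the sets of positive and completely positive maps on $\mathcal{L}(\mathcal{H}_n)$. For $\mathcal{Q}\subset\mathcal{P}_1$, the convex mapping cone generated by $\mathcal{Q}$ is $\mathcal{M}_{\mathcal{Q}}:=\{\sum_i\Phi_i\circ\Omega_i\circ\Psi_i:\Omega_i\in\mathcal{Q},\ \Phi_i,\Psi_i\in\mathcal{CP}\ \forall i\}$ (finite sums). *)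

(* Defs.v *)
From HB Require Import structures.
From mathcomp Require Import all_boot all_order all_algebra.
From mathcomp Require Import classical_sets reals.
From mathcomp.real_closed Require Export complex mxtens.

Set Implicit Arguments.
Unset Strict Implicit.
Unset Printing Implicit Defensive.

Import Order.TTheory GRing.Theory Num.Theory.
Local Open Scope ring_scope.
Local Open Scope complex_scope.
Local Open Scope sesquilinear_scope.
Local Open Scope classical_set_scope.

(* The Hilbert space of dimension n is C^n with its standard inner product, so
   its operators are 'M[R[i]]_n, and the linear maps on these operators are
   'End('M[R[i]]_n). *)

Section PositiveMaps.
Variable R : realType.
Implicit Types n k : nat.

(* On R[i], 0 <= z says that z is real and nonnegative; hence a matrix that is
   positive in this sense is automatically Hermitian. *)
Definition psdmx n (A : 'M[R[i]]_n) : Prop :=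
  forall v : 'cV[R[i]]_n, 0 <= (v^t* *m A *m v) 0 0.

Definition positive_map n (Phi : 'End('M[R[i]]_n)) : Prop :=
  forall X : 'M[R[i]]_n, psdmx X -> psdmx (Phi X).

(* X = \sum_(i, j) E_ij (x) tens_block X i j for X acting on C^k (x) C^n. *)
Definition tens_block k n (X : 'M[R[i]]_(k * n)) (i j : 'I_k) : 'M[R[i]]_n :=
  \matrix_(p, q) X (mxtens_index (i, p)) (mxtens_index (j, q)).

Definition id_tens_fun k n (Phi : 'End('M[R[i]]_n)) (X : 'M[R[i]]_(k * n)) :
    'M[R[i]]_(k * n) :=
  \sum_(i < k) \sum_(j < k) delta_mx i j *t Phi (tens_block X i j).

(* id_k (x) Phi, where C^k (x) C^n is identified with C^(k * n) via
   mxtens_index; id_tens_tensmx is its defining property. *)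
Definition id_tens k n (Phi : 'End('M[R[i]]_n)) : 'End('M[R[i]]_(k * n)) :=
  linfun (id_tens_fun (k := k) Phi).

Lemma id_tens_funE k n (Phi : 'End('M[R[i]]_n)) X i j p q :
  id_tens_fun Phi X (mxtens_index (i, p)) (mxtens_index (j, q))
  = Phi (tens_block (k := k) X i j) p q.
Proof.
rewrite /id_tens_fun summxE (bigD1 i) //= summxE (bigD1 j) //=.
rewrite tensmxE mxE !eqxx mul1r big1 ?addr0 ?big1 ?addr0 // => [i' ne_i|j' ne_j].
  rewrite summxE big1 // => j' _.
  by rewrite tensmxE mxE eq_sym (negPf ne_i) mul0r.
by rewrite tensmxE mxE (eq_sym j) (negPf ne_j) andbF mul0r.
Qed.

Lemma id_tens_fun_is_linear k n (Phi : 'End('M[R[i]]_n)) :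
  linear (id_tens_fun (k := k) Phi).
Proof.
move=> a X Y; apply/matrixP=> r s.
case: (mxtens_indexP r) => i p; case: (mxtens_indexP s) => j q.
rewrite !mxE !id_tens_funE.
have -> : tens_block (a *: X + Y) i j = a *: tens_block X i j + tens_block Y i j.
  by apply/matrixP=> x y; rewrite !mxE.
by rewrite linearP !mxE.
Qed.

HB.instance Definition _ k n (Phi : 'End('M[R[i]]_n)) :=
  GRing.isLinear.Build R[i] 'M[R[i]]_(k * n) 'M[R[i]]_(k * n) _
    (id_tens_fun (k := k) Phi) (@id_tens_fun_is_linear k n Phi).

Lemma id_tensE k n (Phi : 'End('M[R[i]]_n)) (X : 'M[R[i]]_(k * n)) :
  id_tens k Phi X = id_tens_fun Phi X.
Proof. by rewrite /id_tens lfunE. Qed.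

Lemma id_tens_tensmx k n (Phi : 'End('M[R[i]]_n)) (A : 'M[R[i]]_k)
    (X : 'M[R[i]]_n) :
  id_tens k Phi (A *t X) = A *t Phi X.
Proof.
rewrite id_tensE; apply/matrixP=> r s.
case: (mxtens_indexP r) => i p; case: (mxtens_indexP s) => j q.
rewrite id_tens_funE tensmxE.
have -> : tens_block (A *t X) i j = A i j *: X.
  by apply/matrixP=> x y; rewrite mxE tensmxE mxE.
by rewrite linearZ mxE.
Qed.

Definition completely_positive_map n (Phi : 'End('M[R[i]]_n)) : Prop :=
  forall k, positive_map (id_tens k Phi).

Definition P1 n : set 'End('M[R[i]]_n) := [set Phi | positive_map Phi].
Arguments P1 n : clear implicits.

Definition CP n : set 'End('M[R[i]]_n) := [set Phi | completely_positive_map Phi].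
Arguments CP n : clear implicits.

(* The family Q is meant to be a subset of P1 n; the formula does not use it. *)
Definition convex_mapping_cone n (Q : set 'End('M[R[i]]_n)) :
    set 'End('M[R[i]]_n) :=
  [set Xi | exists (m : nat) (Phi Omega Psi : 'I_m -> 'End('M[R[i]]_n)),
     (forall i, [/\ Q (Omega i), CP n (Phi i) & CP n (Psi i)]) /\
     Xi = \sum_(i < m) (Phi i \o Omega i \o Psi i)%VF].

Lemma id_subset_P1 n : [set \1%VF : 'End('M[R[i]]_n)] `<=` P1 n.
Proof. by move=> _ -> X; rewrite id_lfunE. Qed.

End PositiveMaps.

Arguments P1 R n : clear implicits.
Arguments CP R n : clear implicits.

(* Main.v *)
Require Import Defs.
From mathcomp Require Import all_boot all_order all_algebra.
From mathcomp Require Import classical_sets reals.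

Local Open Scope ring_scope.
Local Open Scope complex_scope.
Local Open Scope classical_set_scope.

Import GRing.Theory Num.Theory.

(** With the identity in the middle, each term of the cone is a composite of two completely positive
    maps, so one inclusion says that complete positivity survives composition ([CP_comp]) and finite
    sums ([CP_sum]). Both follow because tensoring with [id_k] respects composition and sums, and
    positivity is stable under them. The other inclusion writes a map as itself composed with
    identities, which needs [CP_id]. *)

Lemma tens_block_id_tens (R : realType) (k n : nat) (Phi : 'End('M[R[i]]_n))
    (X : 'M[R[i]]_(k * n)) (i j : 'I_k) :
  tens_block (id_tens k Phi X) i j = Phi (tens_block X i j).
Proof. by apply/matrixP => p q; rewrite mxE id_tensE id_tens_funE. Qed.

(** Since [id_tens k Phi] applies [Phi] to each block separately, this reduces the compatibility of
    [id_tens] with identity, composition and sums to single blocks. *)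
Lemma tens_block_inj (R : realType) (k n : nat) (X Y : 'M[R[i]]_(k * n)) :
  (forall i j : 'I_k, tens_block X i j = tens_block Y i j) -> X = Y.
Proof.
move=> eqXY; apply/matrixP => r s.
case: (mxtens_indexP r) => i p; case: (mxtens_indexP s) => j q.
by have /matrixP/(_ p q) := eqXY i j; rewrite !mxE.
Qed.

Lemma id_tens_id (R : realType) (k n : nat) :
  id_tens k (\1%VF : 'End('M[R[i]]_n)) = \1%VF.
Proof.
apply/lfunP => X; apply: tens_block_inj => i j.
by rewrite tens_block_id_tens !id_lfunE.
Qed.

Lemma id_tens_comp (R : realType) (k n : nat) (Phi Psi : 'End('M[R[i]]_n)) :
  id_tens k (Phi \o Psi)%VF = (id_tens k Phi \o id_tens k Psi)%VF.
Proof.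
apply/lfunP => X; apply: tens_block_inj => i j.
by rewrite comp_lfunE !tens_block_id_tens comp_lfunE.
Qed.

Lemma id_tens_sum (R : realType) (k n m : nat)
    (Phi : 'I_m -> 'End('M[R[i]]_n)) :
  id_tens k (\sum_(l < m) Phi l) = \sum_(l < m) id_tens k (Phi l).
Proof.
apply/lfunP => X; apply: tens_block_inj => i j.
rewrite tens_block_id_tens !sum_lfunE; apply/matrixP => p q.
rewrite !(mxE, summxE); apply: eq_bigr => l _.
by rewrite -tens_block_id_tens mxE.
Qed.

Lemma psdmx_sum (R : realType) (n m : nat) (A : 'I_m -> 'M[R[i]]_n) :
  (forall l, psdmx (A l)) -> psdmx (\sum_(l < m) A l).
Proof.
move=> psdA v; rewrite mulmx_sumr mulmx_suml summxE.
by apply: sumr_ge0 => l _; apply: psdA.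
Qed.

Lemma CP_id (R : realType) (n : nat) : CP R n \1%VF.
Proof. by move=> k X psdX; rewrite id_tens_id id_lfunE. Qed.

Lemma CP_comp (R : realType) (n : nat) (Phi Psi : 'End('M[R[i]]_n)) :
  CP R n Phi -> CP R n Psi -> CP R n (Phi \o Psi)%VF.
Proof.
move=> cpPhi cpPsi k X psdX; rewrite id_tens_comp comp_lfunE.
exact/cpPhi/cpPsi.
Qed.

Lemma CP_sum (R : realType) (n m : nat) (Phi : 'I_m -> 'End('M[R[i]]_n)) :
  (forall l, CP R n (Phi l)) -> CP R n (\sum_(l < m) Phi l).
Proof.
move=> cpPhi k X psdX; rewrite id_tens_sum sum_lfunE.
by apply: psdmx_sum => l; apply: cpPhi.
Qed.

Theorem proposition1 (R : realType) (n : nat) :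
  convex_mapping_cone [set \1%VF : 'End('M[R[i]]_n)] = CP R n.
Proof.
apply/seteqP; split => [_ [m [Phi [Omega [Psi [cone ->]]]]]|Xi cpXi].
  (* Membership in the singleton forces [Omega l] to be the identity; the empty sum, [m = 0], is
     covered too. *)
  apply: CP_sum => l; have [-> cpPhi cpPsi] := cone l.
  by rewrite comp_lfun1r; apply: CP_comp.
(* A single term suffices, with [Xi] as the left factor. *)
exists 1%N, (fun=> Xi), (fun=> \1%VF), (fun=> \1%VF).
split=> [_|]; first by split => //; exact: CP_id.
by rewrite big_ord1 !comp_lfun1r.
Qed.
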